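(* Let $(R,m,k)$ be a complete regular local ring with algebraically closed residue field $k$. Suppose that for every $r\ge 1$, every choice of monic polynomials $f_i(y_i)=y_i^{n_i}+a_{i,1}y_i^{n_i-1}+\cdots+a_{i,n_i}\in R[y_i]$ ($i=1,\dots,r$, $n_i\ge 1$) with all $a_{i,j}\in m$, and every ideal $J$ of height zero in $$T=R[y_1,\dots,y_r]/(f_1(y_1),\dots,f_r(y_r))$$ such that the natural map $R\to T/J$ is injective, the ring $R$ is a direct summand of $T/J$ as an $R$-module. Then for every module-finite ring extension $R\hookrightarrow S$, $R$ is a direct summand of $S$ as an $R$-module (i.e. there is an $R$-linear map $\rho:S\to R$ with $\rho(1)=1$).
   Context: All rings are commutative Noetherian with identity. *)

(* Defs.v *)
From HB Require Import structures.
From mathcomp Require Import all_boot all_order all_algebra.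
Set Implicit Arguments. Unset Strict Implicit. Unset Printing Implicit Defensive.
Import Order.TTheory GRing.Theory Num.Theory.
Local Open Scope ring_scope.

Section CommAlg.
Variable R : comNzRingType.

Definition is_ideal (I : R -> Prop) : Prop :=
  I 0 /\ (forall x y, I x -> I y -> I (x + y)) /\ (forall a x, I x -> I (a * x)).

Definition ideal_gen (s : seq R) (x : R) : Prop :=
  exists c : seq R, x = \sum_(i < size s) c`_i * s`_i.

Definition fg_ideal (I : R -> Prop) : Prop :=
  exists s : seq R, forall x, I x <-> ideal_gen s x.

Definition noetherian : Prop := forall I, is_ideal I -> fg_ideal I.

Definition is_unit_el (x : R) : Prop := exists y, x * y = 1.

Definition prime_ideal (P : R -> Prop) : Prop :=
  is_ideal P /\ ~ P 1 /\ (forall x y, P (x * y) -> P x \/ P y).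

Definition strict_sub (P Q : R -> Prop) : Prop :=
  (forall x, P x -> Q x) /\ exists x, Q x /\ ~ P x.

Definition prime_chain (c : nat -> R -> Prop) (n : nat) : Prop :=
  (forall i, (i <= n)%N -> prime_ideal (c i)) /\
  (forall i, (i < n)%N -> strict_sub (c i) (c i.+1)).

Definition krull_dim_eq (d : nat) : Prop :=
  (exists c, prime_chain c d) /\ ~ (exists c, prime_chain c d.+1).

Definition prime_height_ge (P : R -> Prop) (n : nat) : Prop :=
  exists c, prime_chain c n /\ (forall x, c n x <-> P x).

(* height J = min over primes P containing J of height P, which is 0 *)
Definition height_zero (J : R -> Prop) : Prop :=
  exists P, prime_ideal P /\ (forall x, J x -> P x) /\ ~ prime_height_ge P 1.

Definition local_ring_with (m : R -> Prop) : Prop :=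
  is_ideal m /\ ~ m 1 /\ (forall x, ~ m x -> is_unit_el x).

Fixpoint ideal_pow (m : R -> Prop) (n : nat) : R -> Prop :=
  match n with
  | 0 => fun _ => True
  | n'.+1 => fun x => exists s : seq (R * R),
       (forall i, (i < size s)%N -> m (nth (0, 0) s i).1 /\ ideal_pow m n' (nth (0, 0) s i).2)
       /\ x = \sum_(p <- s) p.1 * p.2
  end.

Definition madic_complete (m : R -> Prop) : Prop :=
  (forall x, (forall n, ideal_pow m n x) -> x = 0) /\
  (forall u : nat -> R,
     (forall k, exists N, forall p q, (N <= p)%N -> (N <= q)%N -> ideal_pow m k (u p - u q)) ->
     exists L, forall k, exists N, forall n, (N <= n)%N -> ideal_pow m k (u n - L)).

Definition regular_local (m : R -> Prop) : Prop :=
  exists d, krull_dim_eq d /\ exists s : seq R, size s = d /\ (forall x, m x <-> ideal_gen s x).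

(* residue field R/m is algebraically closed: every monic nonconstant polynomial
   over R/m (lifted to a monic polynomial over R) has a root in R/m *)
Definition residue_alg_closed (m : R -> Prop) : Prop :=
  forall p : {poly R}, p \is monic -> (1 < size p)%N -> exists a, m p.[a].

Definition complete_regular_local_alg_closed (m : R -> Prop) : Prop :=
  noetherian /\ local_ring_with m /\ madic_complete m /\ regular_local m /\
  residue_alg_closed m.

Definition R_linear (S : comNzRingType) (f : {rmorphism R -> S}) (rho : S -> R) : Prop :=
  forall a x y, rho (f a * x + y) = a * rho x + rho y.

Definition module_finite (S : comNzRingType) (f : {rmorphism R -> S}) : Prop :=
  exists s : seq S, forall x, exists c : seq R, x = \sum_(i < size s) f c`_i * s`_i.

Definition direct_summand (S : comNzRingType) (f : {rmorphism R -> S}) : Prop :=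
  exists rho : S -> R, R_linear f rho /\ rho 1 = 1.

(* (T, g, y) is R[y_1..y_r]/(F_1(y_1),...,F_r(y_r)), via its universal property *)
Definition is_poly_quotient (r : nat) (F : 'I_r -> {poly R})
  (T : comNzRingType) (g : {rmorphism R -> T}) (y : 'I_r -> T) : Prop :=
  (forall i, (map_poly g (F i)).[y i] = 0) /\
  forall (T' : comNzRingType) (g' : {rmorphism R -> T'}) (y' : 'I_r -> T'),
    (forall i, (map_poly g' (F i)).[y' i] = 0) ->
    (exists h : {rmorphism T -> T'}, (forall a, h (g a) = g' a) /\ (forall i, h (y i) = y' i)) /\
    (forall h1 h2 : {rmorphism T -> T'},
       (forall a, h1 (g a) = g' a) -> (forall i, h1 (y i) = y' i) ->
       (forall a, h2 (g a) = g' a) -> (forall i, h2 (y i) = y' i) ->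
       forall t, h1 t = h2 t).

End CommAlg.

(* f_i(y) = y^n + a_1 y^(n-1) + ... + a_n, with a j = a_(j+1) *)
Definition monic_poly_of (R : comNzRingType) (n : nat) (a : 'I_n -> R) : {poly R} :=
  'X^n + \sum_(j < n) (a j)%:P * 'X^(n - j.+1).

(* Main.v *)
Require Import Defs.
From HB Require Import structures.
From mathcomp Require Import all_boot all_order all_algebra.
From mathcomp Require Import boolp classical_sets.
From mathcomp Require Import ring zify.
Set Implicit Arguments.
Unset Strict Implicit.
Unset Printing Implicit Defensive.
Import GRing.Theory.
Local Open Scope classical_set_scope.
Local Open Scope ring_scope.

(* A regular local ring is a domain, so some prime [P] of [S] meets [R] in 0,
   and it suffices to split [R -> S/P]. Each generator of the domain [S/P] is
   integral over [R]; since [R] is Henselian with algebraically closed residue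
   field, a translate of it by an element of [R] is a root of a monic polynomial
   whose lower coefficients lie in [m]. Hence [S/P] is a quotient of the ring
   [T] attached to these polynomials, and the kernel is a prime of the integral
   extension [T] of [R] lying over 0, so it has height zero by
   incomparability.

   That a regular local ring of dimension d is a domain follows from Krull's
   principal ideal theorem: a chain of d+1 primes can be moved so as to absorb
   the d generators of [m] one at a time, and Nakayama's lemma then shows that
   its bottom is 0. The principal ideal theorem itself is proved without
   constructing localizations, by working with saturated ideals. *)

Lemma Zorn_above (T : Type) (F : set (set T)) (I0 : set T) : F I0 ->
  (forall C, C `<=` F -> C !=set0 -> total_on C subset ->
     F (\bigcup_(X in C) X)) ->
  exists M, [/\ F M, I0 `<=` M & forall J, F J -> M `<=` J -> J `<=` M].
Proof.
move=> FI0 Fchain.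
have [C CF totC|M [FM maxM]] := @Zorn_bigcup T [set X | F (I0 `|` X)].
  pose D := I0 |` [set I0 `|` X | X in C].
  rewrite /= (_ : I0 `|` _ = \bigcup_(X in D) X).
    apply: Fchain; first by move=> _ [->//|[X /CF FX <-]].
      by exists I0; left.
    move=> _ _ [->|[X CX <-]] [->|[Y CY <-]].
    - by left.
    - by left; exact: subsetUl.
    - by right; exact: subsetUl.
    - by have [XY|YX] := totC _ _ CX CY; [left | right]; exact: setUS.
  apply/seteqP; split=> [x [I0x|[X CX Xx]]|x [_ [->|[X CX <-]]]].
  - by exists I0 => //; left.
  - by exists (I0 `|` X); [right; exists X | right].
  - by left.
  - by case=> [|Xx]; [left | right; exists X].
exists (I0 `|` M); split=> // J FJ; rewrite subUset => -[I0J MJ].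
apply: contrapT => nJM; apply: (maxM J); last by rewrite /= (setUidr I0J).
by split=> // JM; apply: nJM => x /JM; right.
Qed.

Section Ideals.
Variable R : comNzRingType.
Implicit Types (I J P : set R).

Lemma ideal0 I : is_ideal I -> I 0. Proof. by case. Qed.

Lemma idealD I x y : is_ideal I -> I x -> I y -> I (x + y).
Proof. by move=> [_ [IDl _]]; exact: IDl. Qed.

Lemma ideal_mull I a x : is_ideal I -> I x -> I (a * x).
Proof. by move=> [_ [_ IM]]; exact: IM. Qed.

Lemma ideal_mulr I a x : is_ideal I -> I x -> I (x * a).
Proof. by rewrite mulrC; exact: ideal_mull. Qed.

Lemma idealN I x : is_ideal I -> I x -> I (- x).
Proof. by rewrite -mulN1r; exact: ideal_mull. Qed.

Lemma idealB I x y : is_ideal I -> I x -> I y -> I (x - y).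
Proof. by move=> idI Ix Iy; apply: idealD => //; exact: idealN. Qed.

Lemma ideal_sum I (T : Type) (s : seq T) (A : pred T) (E : T -> R) :
  is_ideal I -> (forall i, A i -> I (E i)) -> I (\sum_(i <- s | A i) E i).
Proof.
move=> idI IE; apply: big_ind => //; first exact: ideal0.
by move=> x y; exact: idealD.
Qed.

Lemma ideal_full I : is_ideal I -> I 1 -> forall x, I x.
Proof. by move=> idI I1 x; rewrite -[x]mulr1; exact: ideal_mull. Qed.

Lemma is_ideal_zero : is_ideal [set 0 : R].
Proof. by split=> //; split=> [x y -> ->|a x ->]; rewrite ?addr0 ?mulr0. Qed.

Lemma ideal_gen_min (s : seq R) I :
  is_ideal I -> (forall x, x \in s -> I x) -> ideal_gen s `<=` I.
Proof.
move=> idI sI _ [c ->]; apply: ideal_sum => // i _; apply: ideal_mull => //.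
by apply: sI; exact: mem_nth.
Qed.

Lemma mem_ideal_gen (s : seq R) x : x \in s -> ideal_gen s x.
Proof.
move=> xs; exists (set_nth 0 [::] (index x s) 1).
have ltxs : (index x s < size s)%N by rewrite index_mem.
rewrite (bigD1 (Ordinal ltxs)) //= nth_set_nth /= eqxx mul1r nth_index //.
rewrite big1 ?addr0 // => i; rewrite -val_eqE => /negbTE /= i_neq.
by rewrite nth_set_nth /= i_neq nth_nil mul0r.
Qed.

Definition adjoin I x : set R := [set z | exists a r, I a /\ z = a + r * x].

Lemma is_ideal_adjoin I x : is_ideal I -> is_ideal (adjoin I x).
Proof.
move=> idI; split; first by exists 0, 0; split; [exact: ideal0 | ring].
split=> [_ _ [a [r [Ia ->]]] [b [t [Ib ->]]]|c _ [a [r [Ia ->]]]].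
  by exists (a + b), (r + t); split; [exact: idealD | ring].
by exists (c * a), (c * r); split; [exact: ideal_mull | ring].
Qed.

Lemma sub_adjoin I x : I `<=` adjoin I x.
Proof. by move=> a Ia; exists a, 0; split=> //; ring. Qed.

Lemma mem_adjoin I x : is_ideal I -> adjoin I x x.
Proof. by move=> idI; exists 0, 1; split; [exact: ideal0 | ring]. Qed.

Lemma adjoin_min I J x : is_ideal J -> I `<=` J -> J x -> adjoin I x `<=` J.
Proof.
move=> idJ IJ Jx _ [a [r [/IJ Ja ->]]].
by apply: idealD => //; exact: ideal_mull.
Qed.

Lemma adjoinS I J x : I `<=` J -> adjoin I x `<=` adjoin J x.
Proof. by move=> IJ _ [a [r [/IJ Ja ->]]]; exists a, r. Qed.

Lemma proper_adjoin I x : is_ideal I -> ~ I x -> I `<` adjoin I x.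
Proof.
by move=> idI nIx; split=> [|/(_ x (mem_adjoin x idI))//]; exact: sub_adjoin.
Qed.

Definition colon I a : set R := [set r | I (r * a)].

Lemma is_ideal_colon I a : is_ideal I -> is_ideal (colon I a).
Proof.
move=> idI; split; first by rewrite /colon /= mul0r; exact: ideal0.
split=> [x y Ix Iy|c x Ix]; rewrite /colon /=.
  by rewrite mulrDl; exact: idealD.
by rewrite -mulrA; exact: ideal_mull.
Qed.

Lemma sub_colon I a : is_ideal I -> I `<=` colon I a.
Proof. by move=> idI x Ix; exact: ideal_mulr. Qed.

Lemma proper_colon I a b : is_ideal I -> I (a * b) -> ~ I b -> I `<` colon I a.
Proof.
move=> idI Iab nIb; split; first exact: sub_colon.
by move=> /(_ b); apply: contra_not nIb; apply; rewrite /colon /= mulrC.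
Qed.

Lemma prime_exp P x n : prime_ideal P -> P (x ^+ n) -> P x.
Proof.
move=> [_ [nP1 primeP]]; elim: n => [/nP1 //|n IH].
by rewrite exprS => /primeP[].
Qed.

Lemma not_prime_ideal I : is_ideal I -> ~ prime_ideal I ->
  I 1 \/ exists a b, [/\ I (a * b), ~ I a & ~ I b].
Proof.
move=> idI nprI; have [I1|nI1] := pselect (I 1); [by left | right].
apply: contrapT => no_ab; apply: nprI; split=> //; split=> // a b Iab.
by apply: contrapT => /not_orP[nIa nIb]; apply: no_ab; exists a, b.
Qed.

Lemma is_ideal_bigcup (C : set (set R)) : C !=set0 -> C `<=` @is_ideal R ->
  total_on C subset -> is_ideal (\bigcup_(X in C) X).
Proof.
move=> [I0 CI0] idC totC; split.
  by exists I0 => //; apply: ideal0; exact: idC.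
split=> [x y [I CI Ix] [J CJ Jy]|a x [I CI Ix]].
  have [IJ|JI] := totC _ _ CI CJ.
    by exists J => //; apply: idealD; [exact: idC | exact: IJ |].
  by exists I => //; apply: idealD; [exact: idC | | exact: JI].
by exists I => //; apply: ideal_mull => //; exact: idC.
Qed.

Definition mult_closed (A : set R) : Prop :=
  A 1 /\ forall x y, A x -> A y -> A (x * y).

Lemma prime_mult_closed P : prime_ideal P -> mult_closed (~` P).
Proof. by move=> [_ [nP1 primeP]]; split=> // x y nPx nPy /primeP[]. Qed.

Lemma prime_avoiding (A : set R) : mult_closed A -> ~ A 0 ->
  exists2 P, prime_ideal P & P `<=` ~` A.
Proof.
move=> [A1 AM] nA0.
have [||P [[idP PA] _ maxP]] :=
    @Zorn_above R [set I | is_ideal I /\ I `<=` ~` A] [set 0].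
- by split; [exact: is_ideal_zero | move=> x ->].
- move=> C CF C0 totC; split; last by move=> x [I /CF[_]]; exact.
  by apply: is_ideal_bigcup => // I /CF[].
have meets x : ~ P x -> exists2 a, adjoin P x a & A a.
  move=> nPx; apply: contrapT => no_a; apply: nPx.
  apply: (maxP (adjoin P x)); [|exact: sub_adjoin|exact: mem_adjoin].
  by split; [exact: is_ideal_adjoin | move=> a Pxa Aa; apply: no_a; exists a].
exists P => //; split=> //; split=> [/PA //|x y Pxy].
apply: contrapT => /not_orP[/meets[_ [a [r [Pa ->]]] Ax]].
move=> /meets[_ [b [t [Pb ->]]] Ay].
apply: (PA _ _ (AM _ _ Ax Ay)).
have -> : (a + r * x) * (b + t * y) =
  (b + t * y) * a + r * x * b + r * t * (x * y) by ring.
by do 2?[apply: idealD => //]; exact: ideal_mull.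
Qed.

End Ideals.

Section NoetherianInduction.
Variable R : comNzRingType.
Hypothesis noeR : noetherian R.
Implicit Types (I J K : set R).

Lemma finite_sub_chain (C : set (set R)) (s : seq R) : C !=set0 ->
  total_on C subset -> (forall x, x \in s -> (\bigcup_(X in C) X) x) ->
  exists2 I, C I & forall x, x \in s -> I x.
Proof.
move=> [I0 CI0] totC; elim: s => [_|x s IH sC]; first by exists I0.
have [|I CI sI] := IH; first by move=> y ys; apply: sC; rewrite inE ys orbT.
have [|J CJ Jx] := sC x; first by rewrite inE eqxx.
have [IJ|JI] := totC _ _ CI CJ.
  by exists J => // y; rewrite inE => /predU1P[->|/sI /IJ].
by exists I => // y; rewrite inE => /predU1P[->|/sI //]; exact: JI.
Qed.

Lemma noetherian_chain_bigcup (C : set (set R)) : C !=set0 ->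
  C `<=` @is_ideal R -> total_on C subset -> C (\bigcup_(X in C) X).
Proof.
move=> C0 idC totC; have [s genC] := noeR (is_ideal_bigcup C0 idC totC).
have [x xs|I CI sI] := @finite_sub_chain C s C0 totC.
  exact/genC/mem_ideal_gen.
suff -> : \bigcup_(X in C) X = I by [].
apply/seteqP; split=> [x /genC|x Ix]; last by exists I.
by apply: ideal_gen_min => //; exact: idC.
Qed.

Lemma noetherian_ind (T : set (set R)) :
  (forall K, is_ideal K -> (forall J, is_ideal J -> K `<` J -> T J) -> T K) ->
  forall K, is_ideal K -> T K.
Proof.
move=> step K0 idK0; apply: contrapT => nTK0.
have [|C CF C0 totC|K [[idK nTK] _ maxK]] :=
    @Zorn_above R [set K | is_ideal K /\ ~ T K] K0.
- by [].
- by apply: (CF); apply: noetherian_chain_bigcup => // I /CF[].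
apply/nTK/step => // J idJ [KJ nJK].
by apply: contrapT => nTJ; apply: nJK; exact: maxK.
Qed.

End NoetherianInduction.

Section Saturation.
Variables (R : comNzRingType) (A : set R).
Hypothesis multA : mult_closed A.
Implicit Types (I J K P : set R).

Definition saturated I : Prop := forall s x, A s -> I (s * x) -> I x.

Definition saturation I : set R := [set x | exists2 s, A s & I (s * x)].

Lemma is_ideal_saturation I : is_ideal I -> is_ideal (saturation I).
Proof.
move=> idI; split.
  by exists 1; [exact: multA.1 | rewrite mulr0; exact: ideal0].
split=> [x y [s As Isx] [t At Ity]|a x [s As Isx]].
  exists (s * t); first exact: multA.2.
  have -> : s * t * (x + y) = t * (s * x) + s * (t * y) by ring.
  by apply: idealD => //; exact: ideal_mull.
by exists s => //; rewrite mulrCA; exact: ideal_mull.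
Qed.

Lemma saturation_saturated I : saturated (saturation I).
Proof.
move=> s x As [t At Itsx]; exists (t * s); first exact: multA.2.
by rewrite -mulrA.
Qed.

Lemma sub_saturation I : I `<=` saturation I.
Proof. by move=> x Ix; exists 1; [exact: multA.1 | rewrite mul1r]. Qed.

Lemma saturationS I J : I `<=` J -> saturation I `<=` saturation J.
Proof. by move=> IJ x [s As /IJ Jsx]; exists s. Qed.

Lemma saturation_min I J : saturated J -> I `<=` J -> saturation I `<=` J.
Proof. by move=> satJ IJ x [s As /IJ]; exact: satJ. Qed.

Lemma saturated_colon I a : saturated I -> saturated (colon I a).
Proof. by move=> satI s x As; rewrite /colon /= -mulrA; exact: satI. Qed.

Lemma saturated_full I s :
  is_ideal I -> saturated I -> A s -> I s -> forall x, I x.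
Proof. by move=> idI satI As Is x; apply: satI As _; exact: ideal_mulr. Qed.

(* The hypothesis on [u] puts it in the Jacobson radical of the localization. *)
Lemma saturated_nakayama I J u : noetherian R ->
  (forall s r, A s -> A (s - u * r)) ->
  is_ideal I -> is_ideal J -> saturated I -> saturated J -> I `<=` J ->
  (forall z, J z -> exists s a r, [/\ A s, I a, J r & s * z = a + u * r]) ->
  J `<=` I.
Proof.
move=> noeR radu idI idJ satI satJ IJ J_decomp.
suff all_between K :
    is_ideal K -> saturated K -> I `<=` K -> K `<=` J -> J `<=` K.
  exact: all_between.
move: K; apply: noetherian_ind => // K idK IH satK IK KJ g Jg.
apply: contrapT => nKg; have idKg := is_ideal_adjoin g idK.
have JKg : J `<=` saturation (adjoin K g).
  have KKg : K `<` saturation (adjoin K g).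
    split=> [x Kx|]; first by apply: sub_saturation; exact: sub_adjoin.
    by move=> /(_ g) satg; apply/nKg/satg/sub_saturation/mem_adjoin.
  apply: (IH _ (is_ideal_saturation idKg) KKg).
  - exact: saturation_saturated.
  - exact: subset_trans IK KKg.1.
  - by apply: saturation_min => //; exact: adjoin_min.
have [s [a [r [As Ia Jr sg]]]] := J_decomp _ Jg.
have [t At [k [c [Kk tr]]]] := JKg _ Jr.
apply: nKg; apply: (satK (t * s - u * c)); first by apply: radu; exact: multA.2.
have -> : (t * s - u * c) * g = t * a + u * k.
  have -> : t * a + u * k = t * (a + u * r) - u * (t * r - k) by ring.
  by rewrite -sg tr; ring.
by apply: idealD => //; apply: ideal_mull => //; exact: IK.
Qed.

(* The saturated ideals represent the ideals of the localization of [R] at [A],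
   so this says that the localization of [R / K] at [A] is Artinian. *)
Definition artinian_over K : Prop :=
  forall L : nat -> set R,
    (forall n, [/\ is_ideal (L n), saturated (L n),
                   K `<=` L n & L n.+1 `<=` L n]) ->
  exists N, forall n, (N <= n)%N -> L n `<=` L n.+1.

Lemma artinian_overS K J : K `<=` J -> artinian_over K -> artinian_over J.
Proof.
move=> KJ artK L chainL; apply: artK => n; have [idL satL JL decrL] := chainL n.
by split=> //; exact: subset_trans JL.
Qed.

Lemma artinian_over_meeting K s : A s -> K s -> artinian_over K.
Proof.
move=> As Ks L chainL; exists 0 => n _ x _; have [idL satL KL _] := chainL n.+1.
by apply: saturated_full As _ _ => //; exact: KL.
Qed.

(* The chains [L + (a)] and [L : a] together determine the chain [L]. *)
Lemma artinian_over_adjoin_colon K a :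
  artinian_over (adjoin K a) -> artinian_over (colon K a) -> artinian_over K.
Proof.
move=> art_adjoin art_colon L chainL.
have [n|N1 stable_adjoin] := art_adjoin (fun n => saturation (adjoin (L n) a)).
  have [idL satL KL decrL] := chainL n; have idLa := is_ideal_adjoin a idL.
  split; [exact: is_ideal_saturation|exact: saturation_saturated| |].
    by apply: subset_trans (sub_saturation (I := _)); exact: adjoinS.
  by apply: saturationS; exact: adjoinS.
have [n|N2 stable_colon] := art_colon (fun n => colon (L n) a).
  have [idL satL KL decrL] := chainL n.
  split; [exact: is_ideal_colon|exact: saturated_colon| |].
    by move=> r; exact: KL.
  by move=> r; exact: decrL.
exists (maxn N1 N2) => n; rewrite geq_max => /andP[leN1 leN2] y Ly.
have [idL satL _ decrL] := chainL n; have [idL1 satL1 _ _] := chainL n.+1.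
have [|s As [l [r [Ll sy]]]] := stable_adjoin n leN1 y.
  by apply: sub_saturation; exact: sub_adjoin.
apply: (satL1 s) => //; rewrite sy; apply: idealD => //.
apply: stable_colon => //; rewrite /colon /=.
have -> : r * a = s * y - l by rewrite sy; ring.
by apply: idealB => //; [exact: ideal_mull | exact: decrL].
Qed.

Lemma artinian_over_primes K : noetherian R -> is_ideal K ->
  (forall P, prime_ideal P -> K `<=` P -> artinian_over P) -> artinian_over K.
Proof.
move=> noeR; move: K; apply: noetherian_ind => // K idK IH artP.
have IH_above J : is_ideal J -> K `<` J -> artinian_over J.
  move=> idJ KJ; apply: IH => // P prP JP.
  exact: artP prP (subset_trans KJ.1 JP).
have [prK|nprK] := pselect (prime_ideal K); first exact: artP.
have [K1|[a [b [Kab nKa nKb]]]] := not_prime_ideal idK nprK.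
  by apply: artinian_over_meeting K1; exact: multA.1.
apply: (@artinian_over_adjoin_colon K a); apply: IH_above.
- exact: is_ideal_adjoin.
- exact: proper_adjoin.
- exact: is_ideal_colon.
- exact: proper_colon Kab nKb.
Qed.

Lemma artinian_over_prime_sub P0 P1 : prime_ideal P0 -> prime_ideal P1 ->
  P0 `<=` P1 -> P1 `<=` ~` A -> artinian_over P0 -> P1 `<=` P0.
Proof.
move=> prP0 prP1 P01 P1A artP0 y P1y; apply: contrapT => nP0y.
have idP0 := prP0.1.
have [n|N stableN] := artP0 (fun n => saturation (adjoin P0 (y ^+ n))).
  have idP0y := is_ideal_adjoin (y ^+ n) idP0.
  split; [exact: is_ideal_saturation|exact: saturation_saturated| |].
    by apply: subset_trans (sub_saturation (I := _)); exact: sub_adjoin.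
  apply: saturationS; apply: adjoin_min (sub_adjoin _) _ => //.
  by rewrite exprS; apply: ideal_mull => //; exact: mem_adjoin.
have [|s As [a [r [P0a sy]]]] := stableN N (leqnn N) (y ^+ N).
  by apply: sub_saturation; exact: mem_adjoin.
have : P0 (y ^+ N * (s - r * y)).
  suff -> : y ^+ N * (s - r * y) = a by [].
  have -> : a = s * y ^+ N - r * y ^+ N.+1 by rewrite sy; ring.
  by rewrite exprS; ring.
move=> /prP0.2.2[/(prime_exp prP0) //|/P01 P1sry]; apply: (P1A s) => //.
rewrite -(subrK (r * y) s); apply: idealD P1sry _; first exact: prP1.1.
by apply: ideal_mull => //; exact: prP1.1.
Qed.

End Saturation.

Section PrincipalIdealTheorem.
Variable R : comNzRingType.
Hypothesis noeR : noetherian R.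
Implicit Types (K P Q : set R).

Definition minimal_prime_over K Q : Prop :=
  [/\ prime_ideal Q, K `<=` Q &
      forall P, prime_ideal P -> K `<=` P -> P `<=` Q -> Q `<=` P].

Lemma artinian_over_localized_prime Q : prime_ideal Q -> artinian_over (~` Q) Q.
Proof.
move=> prQ L chainL.
have L_sub_Q n : ~ L n 1 -> L n `<=` Q.
  have [idL satL _ _] := chainL n.
  move=> nL1 x Lx; apply: contrapT => nQx; apply: nL1.
  exact: (saturated_full idL satL nQx Lx 1).
have [[N nLN1]|all_full] := pselect (exists N, ~ L N 1).
  exists N => n /subnK <- x.
  have nLn1 : ~ L (n - N + N)%N 1.
    elim: (n - N)%N => [//|d IH] Ld1; apply: IH.
    by have [_ _ _] := chainL (d + N)%N; apply.
  by have [_ _ QL _] := chainL (n - N + N).+1; move=> /(L_sub_Q _ nLn1)/QL.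
exists 0 => n _ x _; have [idL _ _ _] := chainL n.+1.
apply: ideal_full => //.
by apply: contrapT => nL1; apply: all_full; exists n.+1.
Qed.

Lemma artinian_over_minimal_prime K Q : is_ideal K -> minimal_prime_over K Q ->
  artinian_over (~` Q) K.
Proof.
move=> idK [prQ KQ minQ]; have multQ := prime_mult_closed prQ.
apply: artinian_over_primes => // P prP KP.
have [PQ|/existsNP[s /not_implyP[Ps nQs]]] := pselect (P `<=` Q).
  apply: artinian_overS (artinian_over_localized_prime prQ).
  exact: minQ.
exact: artinian_over_meeting nQs Ps.
Qed.

Definition away_from Q u : set R :=
  [set s | exists t k, ~ Q t /\ s = t * u ^+ k].

Lemma away_from_mult_closed Q u : prime_ideal Q -> mult_closed (away_from Q u).
Proof.
move=> /prime_mult_closed[nQ1 QM]; split; first by exists 1, 0%N; rewrite mulr1.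
move=> _ _ [s [k [nQs ->]]] [t [l [nQt ->]]].
by exists (s * t), (k + l)%N; split; [exact: QM | rewrite exprD; ring].
Qed.

(* Modulo [u] the chain is stationary because [Q] is minimal over [K + (u)];
   since [u] acts injectively modulo its terms, Nakayama's lemma applies. *)
Lemma artinian_over_away K Q u : is_ideal K ->
  minimal_prime_over (adjoin K u) Q -> artinian_over (away_from Q u) K.
Proof.
move=> idK minQ L chainL; have [prQ KuQ _] := minQ.
have multQ := prime_mult_closed prQ; have idQ := prQ.1.
have Qu : Q u by apply: KuQ; exact: mem_adjoin.
have satQ n : saturated (~` Q) (L n).
  have [_ satL _ _] := chainL n => s x nQs; apply: satL.
  by exists s, 0%N; rewrite mulr1.
have u_cancel n x : L n (u * x) -> L n x.
  have [_ satL _ _] := chainL n; apply: satL.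
  by exists 1, 1%N; rewrite mul1r; split=> //; exact: multQ.1.
have [|N stableN] := artinian_over_minimal_prime (is_ideal_adjoin u idK) minQ
    (L := fun n => saturation (~` Q) (adjoin (L n) u)).
  move=> n; have [idL _ KL decrL] := chainL n.
  have idLu := is_ideal_adjoin u idL.
  split; [exact: is_ideal_saturation|exact: saturation_saturated| |].
    by apply: subset_trans (sub_saturation multQ (I := _)); exact: adjoinS.
  by apply: saturationS; exact: adjoinS.
exists N => n leNn; have [idL _ _ decrL] := chainL n.
have [idL1 _ _ _] := chainL n.+1.
apply: (saturated_nakayama multQ (u := u)) => //.
  move=> s r nQs Qsur; apply: nQs; rewrite -(subrK (u * r) s).
  by apply: idealD => //; exact: ideal_mulr.
move=> z Lz; have [|s nQs [a [r [La sz]]]] := stableN n leNn z.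
  by apply: sub_saturation => //; exact: sub_adjoin.
exists s, a, r; split=> //; last by rewrite sz mulrC.
apply: u_cancel; have -> : u * r = s * z - a by rewrite sz; ring.
by apply: idealB; [| exact: ideal_mull | exact: decrL].
Qed.

Lemma krull_principal_ideal P0 P1 Q u : prime_ideal P0 -> prime_ideal P1 ->
  minimal_prime_over (adjoin P0 u) Q -> P0 `<=` P1 -> strict_sub P1 Q ->
  P1 `<=` P0.
Proof.
move=> prP0 prP1 minQ P01 [P1Q [x [Qx nP1x]]]; have [prQ _ min_below] := minQ.
have nP1u : ~ P1 u.
  move=> P1u; apply/nP1x/(min_below P1) => //.
  by apply: adjoin_min => //; exact: prP1.1.
apply: (@artinian_over_prime_sub R (away_from Q u)) => //.
- exact: away_from_mult_closed.
- move=> y P1y [s [k [nQs ys]]]; move: P1y; rewrite ys.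
  by move=> /prP1.2.2[/P1Q //|/(prime_exp prP1)].
- by apply: artinian_over_away => //; exact: prP0.1.
Qed.

Lemma prime_between_containing P0 P1 Q u :
  prime_ideal P0 -> prime_ideal P1 -> prime_ideal Q ->
  strict_sub P0 P1 -> strict_sub P1 Q -> Q u ->
  exists P, [/\ prime_ideal P, strict_sub P0 P, strict_sub P Q & P u].
Proof.
move=> prP0 prP1 prQ sP01 sP1Q Qu; have idQ := prQ.1.
have [P1u|nP1u] := pselect (P1 u); first by exists P1.
have [P01 [y [P1y nP0y]]] := sP01.
apply: contrapT => no_P; apply: nP0y.
apply: (krull_principal_ideal (u := u) prP0 prP1 _ P01 sP1Q P1y); split=> //.
  by apply: adjoin_min => // x /P01 /sP1Q.1.
move=> P prP P0uP PQ x Qx; apply: contrapT => nPx; apply: no_P.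
have Pu : P u by apply: P0uP; apply: mem_adjoin; exact: prP0.1.
exists P; split=> //; last by split=> //; exists x.
split; first exact: subset_trans (@sub_adjoin _ P0 u) P0uP.
by exists u; split=> // /P01.
Qed.

End PrincipalIdealTheorem.

Section RegularLocalDomain.
Variable R : comNzRingType.
Hypothesis noeR : noetherian R.
Implicit Types (I J P : set R) (c : nat -> R -> Prop).

Lemma prime_chain_rcons c n P : prime_chain c n -> prime_ideal P ->
  strict_sub (c n) P ->
  prime_chain (fun i => if (i <= n)%N then c i else P) n.+1.
Proof.
move=> [primec strictc] prP cnP; split=> i; first by case: ifP => // /primec.
by rewrite ltnS /=; case: (ltngtP i n) => // [lt_in _|-> //]; exact: strictc.
Qed.

Lemma prime_chain_belast c n : prime_chain c n.+1 -> prime_chain c n.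
Proof.
move=> [primec strictc]; split=> i le_in; first exact/primec/leqW.
exact/strictc/leqW.
Qed.

Lemma prime_chain_behead c n :
  prime_chain c n.+1 -> prime_chain (fun i => c i.+1) n.
Proof.
by move=> [primec strictc]; split=> i le_in; [exact: primec | exact: strictc].
Qed.

Lemma prime_chain_through c n x : prime_chain c n.+1 -> c n.+1 x ->
  exists c',
    [/\ prime_chain c' n.+1, c' 0%N = c 0%N, c' n.+1 = c n.+1 & c' 1%N x].
Proof.
elim: n c => [|n IH] c chainc cx; first by exists c.
have [primec strictc] := chainc.
have [P [prP strictP Pstrict Px]] := prime_between_containing noeR
  (primec n (leqW (leqnSn _))) (primec n.+1 (leqnSn _)) (primec n.+2 (leqnn _))
  (strictc n (leqnSn _)) (strictc n.+1 (leqnn _)) cx.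
pose d i := if (i <= n)%N then c i else P.
have chaind : prime_chain d n.+1.
  by apply: prime_chain_rcons => //; do 2!apply: prime_chain_belast.
have [|d' [chaind' d'0 d'n d'1]] := IH d chaind; first by rewrite /d ltnn.
exists (fun i => if (i <= n.+1)%N then d' i else c n.+2); split=> //.
- apply: prime_chain_rcons => //; first exact: primec.
  by rewrite d'n /d ltnn.
- by rewrite ltnn.
Qed.

Definition adjoin_seq I (s : seq R) : set R := foldl (@adjoin R) I s.

Lemma sub_adjoin_seq I s : I `<=` adjoin_seq I s.
Proof.
elim: s I => [|x s IH] I //=.
exact: subset_trans (@sub_adjoin _ I x) (IH (adjoin I x)).
Qed.

Lemma adjoin_seq_min I J s : is_ideal J -> I `<=` J ->
  (forall x, x \in s -> J x) -> adjoin_seq I s `<=` J.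
Proof.
move=> idJ; elim: s I => [//|x s IH] I IJ sJ /=; apply: IH => [|y ys].
  by apply: adjoin_min => //; apply: sJ; exact: mem_head.
by apply: sJ; rewrite inE ys orbT.
Qed.

Lemma is_ideal_adjoin_seq I s : is_ideal I -> is_ideal (adjoin_seq I s).
Proof.
by elim: s I => [//|x s IH] I idI /=; apply: IH; exact: is_ideal_adjoin.
Qed.

Lemma mem_adjoin_seq I s x : is_ideal I -> x \in s -> adjoin_seq I s x.
Proof.
elim: s I => [//|y s IH] I idI; rewrite inE => /predU1P[->|xs] /=.
  by apply: sub_adjoin_seq; exact: mem_adjoin.
by apply: IH => //; exact: is_ideal_adjoin.
Qed.

Lemma adjoin_seq_ideal_gen J s : is_ideal J ->
  (forall x, J x <-> ideal_gen s x) -> adjoin_seq [set 0] s = J.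
Proof.
move=> idJ genJ; apply/seteqP; split.
  apply: adjoin_seq_min => // [x ->|x xs]; first exact: ideal0.
  exact/genJ/mem_ideal_gen.
move=> x /genJ; have idz := is_ideal_adjoin_seq s (@is_ideal_zero R).
by apply: ideal_gen_min x => // y; exact/mem_adjoin_seq/is_ideal_zero.
Qed.

Section Local.
Variable m : set R.
Hypothesis locR : local_ring_with m.

Lemma local_prime : prime_ideal m.
Proof.
have [idm [nm1 unitm]] := locR; split=> //; split=> // x y mxy.
apply: contrapT => /not_orP[/unitm[x' xx'] /unitm[y' yy']]; apply: nm1.
have -> : 1 = x' * y' * (x * y) by rewrite -[1]mulr1 -{1}xx' -yy'; ring.
exact: ideal_mull.
Qed.

Lemma prime_sub_local P : prime_ideal P -> P `<=` m.
Proof.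
move=> [idP [nP1 _]] x Px; apply: contrapT => /locR.2.2[y xy].
by apply: nP1; rewrite -xy; exact: ideal_mulr.
Qed.

Lemma saturated_local I : is_ideal I -> saturated (~` m) I.
Proof.
move=> idI s x /locR.2.2[t st] Isx.
by rewrite -[x]mul1r -st mulrAC mulrC; exact: ideal_mull.
Qed.

Lemma prime_sub_of_adjoin I P x : is_ideal I -> prime_ideal P -> I `<=` P ->
  P `<=` adjoin I x -> m x -> ~ P x -> P `<=` I.
Proof.
move=> idI prP IP PIx mx nPx; have idP := prP.1; have [idm [nm1 _]] := locR.
apply: (saturated_nakayama (prime_mult_closed local_prime) (u := x)) => //.
- move=> s r nms msxr; apply: nms; rewrite -(subrK (x * r) s).
  by apply: idealD => //; exact: ideal_mulr.
- exact: saturated_local.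
- exact: saturated_local.
move=> z Pz; have [a [r [Ia zE]]] := PIx _ Pz.
exists 1, a, r; split=> //; last by rewrite mul1r zE mulrC.
have : P (r * x).
  have -> : r * x = z - a by rewrite zE; ring.
  by apply: idealB => //; exact: IP.
by move=> /prP.2.2[].
Qed.

Lemma prime_chain_to_local c n : prime_chain c n ->
  exists2 c', prime_chain c' n & c' n = m.
Proof.
case: n => [_|n chainc].
  by exists (fun=> m) => //; split=> // i _; exact: local_prime.
exists (fun i => if (i <= n)%N then c i else m); last by rewrite ltnn.
apply: prime_chain_rcons; [exact: prime_chain_belast | exact: local_prime |].
have [cn_sub [x [cx ncx]]] := chainc.2 n (leqnn _).
have cm := prime_sub_local (chainc.1 n.+1 (leqnn _)).
by split; [exact: subset_trans cm | exists x; split=> //; exact: cm].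
Qed.

(* Move the chain so that its second member contains the first generator;
   by induction that member is then equal to [I + (x)]. *)
Lemma full_prime_chain_bottom I s c : is_ideal I -> adjoin_seq I s = m ->
  prime_chain c (size s) -> c (size s) = m -> I `<=` c 0%N -> c 0%N `<=` I.
Proof.
elim: s I c => [|x s IH] I c idI genm chainc cm Ic; first by rewrite cm -genm.
have idIx := is_ideal_adjoin x idI.
have mx : m x by rewrite -genm; exact: mem_adjoin_seq (mem_head _ _).
have [|c' [chainc' c'0 c'm c'x]] := prime_chain_through chainc (x := x).
  by rewrite cm.
have prc'0 := chainc'.1 0%N isT; have prc'1 := chainc'.1 1%N isT.
have [c'01 [y [c'1y nc'0y]]] := chainc'.2 0%N isT.
rewrite -c'0 in Ic *.
have c'1Ix : c' 1%N `<=` adjoin I x.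
  apply: IH (prime_chain_behead chainc') _ _ => //; first by rewrite c'm.
  by apply: adjoin_min => //; [exact: prc'1.1 | exact: subset_trans c'01].
apply: (@prime_sub_of_adjoin I _ x) => //; first exact: subset_trans c'1Ix.
move=> c'0x; apply: nc'0y.
by apply: (adjoin_min prc'0.1 Ic c'0x); exact: c'1Ix.
Qed.

Lemma regular_local_domain : regular_local m -> GRing.integral_domain_axiom R.
Proof.
move=> [d [[[c chainc] _] [s [size_s genm]]]] x y xy0.
have [c' chainc' c'm] := prime_chain_to_local chainc.
have prc' := chainc'.1 0%N isT; have zero_ideal := @is_ideal_zero R.
rewrite -size_s in chainc' c'm.
have c'_zero : c' 0%N `<=` [set 0].
  apply: (full_prime_chain_bottom (s := s)) => //.
    by apply: adjoin_seq_ideal_gen => //; exact: locR.1.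
  by move=> _ ->; exact: ideal0 prc'.1.
apply/orP; have : c' 0%N (x * y) by rewrite xy0; exact: ideal0 prc'.1.
by move=> /prc'.2.2[] /c'_zero ->; [left | right].
Qed.

End Local.

End RegularLocalDomain.

Section MonicPolynomials.
Variable R : comNzRingType.
Implicit Types (I : set R) (p q d : {poly R}).

Definition monic_of_degree n p : Prop := p \is monic /\ size p = n.+1.

Lemma monic_of_degreeP n p :
  monic_of_degree n p <-> (size (p - 'X^n)%R <= n)%N.
Proof.
split=> [[/monicP monp sizep]|sizer].
  apply/leq_sizeP => j; rewrite coefB coefXn leq_eqVlt => /predU1P[<-|lt_nj].
    by move: monp; rewrite lead_coefE sizep eqxx => ->; rewrite subrr.
  by rewrite nth_default ?sizep // gtn_eqF // subr0.
rewrite -(subrK 'X^n p) addrC; split; last by rewrite size_polyDl size_polyXn.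
by rewrite monicE lead_coefDl ?size_polyXn // lead_coefXn.
Qed.

Lemma monic_of_degree0 p : monic_of_degree 0 p -> p = 1.
Proof.
by move=> /monic_of_degreeP; rewrite leqn0 size_poly_eq0 subr_eq0 => /eqP.
Qed.

Lemma monic_of_degree_Xn n : monic_of_degree n ('X^n : {poly R}).
Proof. by split; [exact: monicXn | exact: size_polyXn]. Qed.

Lemma monic_of_degreeD n p d :
  monic_of_degree n p -> (size d <= n)%N -> monic_of_degree n (p + d).
Proof.
move=> /monic_of_degreeP sizep sized; apply/monic_of_degreeP.
by rewrite addrAC (leq_trans (size_polyD _ _)) // geq_max sizep.
Qed.

Lemma monic_of_degreeM n k p q : monic_of_degree n p -> monic_of_degree k q ->
  monic_of_degree (n + k) (p * q).
Proof.
move=> [monp sizep] [monq sizeq]; split; first by rewrite monicMl.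
by rewrite size_Mmonic ?monic_neq0 // sizep sizeq addSn addnS.
Qed.

Lemma monic_of_degree_comp n k p q : (0 < k)%N ->
  monic_of_degree n p -> monic_of_degree k q ->
  monic_of_degree (n * k) (p \Po q).
Proof.
move=> k_gt0 /monic_of_degreeP sizer monq.
rewrite -(subrK 'X^n p) addrC comp_polyD; apply: monic_of_degreeD.
  rewrite rmorphXn /= comp_polyX; elim: (n) => [|i IH].
    by rewrite expr0; split; [exact: monic1 | exact: size_poly1].
  by rewrite exprS mulSn; exact: monic_of_degreeM.
have [->|r_neq0] := eqVneq (p - 'X^n) 0; first by rewrite comp_poly0 size_poly0.
apply: leq_trans (size_comp_poly_leq _ _) _; rewrite monq.2.
move: sizer; rewrite -size_poly_gt0 in r_neq0.
case: (size _) r_neq0 => // r _ lt_rn /=.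
by apply: leq_trans (leq_mul lt_rn (leqnn k)); rewrite mulSn -add1n leq_add2r.
Qed.

Lemma size_monicB n p q : monic_of_degree n p -> monic_of_degree n q ->
  (size (p - q)%R <= n)%N.
Proof.
move=> /monic_of_degreeP sizep /monic_of_degreeP sizeq.
have -> : p - q = (p - 'X^n) - (q - 'X^n) by ring.
by rewrite (leq_trans (size_polyD _ _)) // size_polyN geq_max sizep.
Qed.

Definition coefs_in I : set {poly R} := [set p | forall i, I p`_i].

Lemma is_ideal_coefs_in I : is_ideal I -> is_ideal (coefs_in I).
Proof.
move=> idI; split; first by move=> i; rewrite coef0; exact: ideal0.
split=> [p q Ip Iq i|a p Ip i]; first by rewrite coefD; exact: idealD.
by rewrite coefM; apply: ideal_sum => // j _; exact: ideal_mull.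
Qed.

Lemma monic_division I d p : is_ideal I -> d \is monic -> coefs_in I p ->
  exists q r,
    [/\ p = q * d + r, (size r < size d)%N, coefs_in I q & coefs_in I r].
Proof.
move=> idI mond Ip.
pose combine (E : nat -> {poly R}) := \sum_(i < size p) p`_i *: E i.
have coefs_combine E : coefs_in I (combine E).
  move=> j; rewrite coef_sum; apply: ideal_sum => // i _.
  by rewrite coefZ; exact: ideal_mulr.
have pE : combine (fun i => 'X^i) = p by rewrite -[RHS]coefK poly_def.
have rE : combine (fun i => Pdiv.Ring.rmodp 'X^i d) = Pdiv.Ring.rmodp p d.
  rewrite -pE Pdiv.RingMonic.rmodp_sum //.
  by apply: eq_bigr => i _; rewrite Pdiv.RingMonic.rmodpZ.
exists (combine (fun i => Pdiv.Ring.rdivp 'X^i d)).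
exists (combine (fun i => Pdiv.Ring.rmodp 'X^i d)); split=> //.
  rewrite -pE mulr_suml -big_split; apply: eq_bigr => i _ /=.
  by rewrite -scalerAl -scalerDr -Pdiv.RingMonic.rdivp_eq.
by rewrite rE Pdiv.Ring.ltn_rmodp monic_neq0.
Qed.

(* Multiply the relation [U * G + V * H = 1] by [D] and reduce [V * D]
   modulo [G]. *)
Lemma bezout_bounded I e h (G H U V D : {poly R}) : is_ideal I ->
  monic_of_degree e G -> monic_of_degree h H -> U * G + V * H = 1 ->
  (size D <= e + h)%N -> coefs_in I D ->
  exists A B : {poly R}, [/\ (size A <= e)%N, (size B <= h)%N,
    coefs_in I A, coefs_in I B & A * H + B * G = D].
Proof.
move=> idI [monG sizeG] [monH sizeH] bezout sizeD ID.
have idIX := is_ideal_coefs_in idI.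
have [Q [A [VD sizeA IQ IA]]] := monic_division idI monG (ideal_mull V idIX ID).
rewrite sizeG ltnS in sizeA.
pose B := U * D + Q * H; have AB : A * H + B * G = D.
  have -> : A = V * D - Q * G by rewrite VD; ring.
  by rewrite /B -[RHS]mul1r -bezout; ring.
exists A, B; split=> //; last first.
  exact: idealD idIX (ideal_mull U idIX ID) (ideal_mulr H idIX IQ).
have [->|B_neq0] := eqVneq B 0; first by rewrite size_poly0.
have : (size (B * G)%R <= e + h)%N.
  have -> : B * G = D - A * H by rewrite -AB; ring.
  rewrite (leq_trans (size_polyD _ _)) // size_polyN geq_max sizeD.
  have [->|A_neq0] := eqVneq A 0; first by rewrite mul0r size_poly0.
  by rewrite size_Mmonic // sizeH addnS leq_add2r.
by rewrite size_Mmonic // sizeG addnS addnC leq_add2l.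
Qed.

Lemma comaximal_Xn e (H : {poly R}) (t : R) : H`_0 * t = 1 ->
  exists U V : {poly R}, U * 'X^e + V * H = 1.
Proof.
move=> H0t; elim: e => [|e [U [V UV]]].
  by exists 1, 0; rewrite mul0r addr0 mulr1.
pose c := U`_0 * t; pose W := drop_poly 1 (U - c%:P * H).
have WX : W * 'X = U - c%:P * H.
  rewrite -[RHS](poly_take_drop 1) -/W expr1.
  suff -> : take_poly 1 (U - c%:P * H) = 0 by rewrite add0r.
  apply/polyP => -[|i]; rewrite coef_take_poly coef0 //=.
  by rewrite coefB coefCM /c -mulrA (mulrC t) H0t mulr1 subrr.
exists W, (V + c%:P * 'X^e).
have -> : W * 'X^(e.+1) + (V + c%:P * 'X^e) * H =
  W * 'X * 'X^e + c%:P * H * 'X^e + V * H by rewrite exprS; ring.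
by rewrite WX -UV; ring.
Qed.

End MonicPolynomials.

Lemma dependent_choice (T : Type) (P : nat -> set T)
    (E : nat -> T -> T -> Prop) x0 :
  P 0%N x0 -> (forall n x, P n x -> exists2 y, P n.+1 y & E n x y) ->
  exists u : nat -> T,
    (forall n, P n (u n)) /\ (forall n, E n (u n) (u n.+1)).
Proof.
move=> P0 step.
have /choice[next nextP] (nx : nat * T) :
    exists y, P nx.1 nx.2 -> P nx.1.+1 y /\ E nx.1 nx.2 y.
  have [/step[y Py Ey]|nP] := pselect (P nx.1 nx.2); first by exists y.
  by exists x0.
pose u := fix u n := if n is k.+1 then next (k, u k) else x0.
have uP n : P n (u n) by elim: n => [//|n /(nextP (n, u n))[]].
by exists u; split=> // n; have [] := nextP (n, u n) (uP n).
Qed.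

Section Hensel.
Variables (R : comNzRingType) (m : set R).
Hypothesis idm : is_ideal m.
Implicit Types (p q : {poly R}).

Lemma ideal_powS n x : ideal_pow m n.+1 x <->
  exists2 s : seq (R * R), (forall z, z \in s -> m z.1 /\ ideal_pow m n z.2) &
    x = \sum_(z <- s) z.1 * z.2.
Proof.
split=> [[s [ms xE]]|[s ms xE]]; exists s => //.
  by move=> p /(nthP (0, 0))[i lt_is <-]; exact: ms.
by split=> // i lt_is; apply/ms/mem_nth.
Qed.

Lemma is_ideal_pow n : is_ideal (ideal_pow m n).
Proof.
elim: n => [//|n IH]; split.
  by apply/ideal_powS; exists [::]; rewrite ?big_nil.
split=> [x y|a x] /ideal_powS[s ms ->].
  move=> /ideal_powS[t mt ->]; apply/ideal_powS.
  exists (s ++ t); last by rewrite big_cat.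
  by move=> p; rewrite mem_cat => /orP[/ms|/mt].
apply/ideal_powS; exists [seq (a * z.1, z.2) | z <- s].
  by move=> _ /mapP[z /ms[mz1 mz2] ->]; split=> //; exact: ideal_mull.
by rewrite big_map mulr_sumr; apply: eq_bigr => z _; rewrite mulrA.
Qed.

Lemma ideal_powM n x y : m x -> ideal_pow m n y -> ideal_pow m n.+1 (x * y).
Proof.
move=> mx my; apply/ideal_powS; exists [:: (x, y)]; last by rewrite big_seq1.
by move=> p; rewrite inE => /eqP ->.
Qed.

Lemma ideal_powW k n : (k <= n)%N -> ideal_pow m n `<=` ideal_pow m k.
Proof.
move=> /subnK <-; elim: (n - k)%N => [//|d IH] x; rewrite addSn.
move=> /ideal_powS[s ms ->]; apply: IH; rewrite big_seq.
apply: ideal_sum (is_ideal_pow _) _ => z /ms[_].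
exact: ideal_mull (is_ideal_pow _).
Qed.

Lemma ideal_pow1 : ideal_pow m 1 = m.
Proof.
apply/seteqP; split=> x.
  move=> /ideal_powS[s ms ->]; rewrite big_seq.
  by apply: ideal_sum => // p /ms[mp _]; exact: ideal_mulr.
by move=> mx; rewrite -[x]mulr1; exact: ideal_powM.
Qed.

Lemma is_ideal_coefs_in_pow n : is_ideal (coefs_in (ideal_pow m n)).
Proof. exact/is_ideal_coefs_in/is_ideal_pow. Qed.

Lemma coefs_in_powW k n p : (k <= n)%N ->
  coefs_in (ideal_pow m n) p -> coefs_in (ideal_pow m k) p.
Proof. by move=> le_kn np i; exact: ideal_powW le_kn _ (np i). Qed.

Lemma coefs_in_powM n p q : coefs_in m p ->
  coefs_in (ideal_pow m n) q -> coefs_in (ideal_pow m n.+1) (p * q).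
Proof.
move=> mp mq i; rewrite coefM; apply: ideal_sum (is_ideal_pow _) _ => j _.
exact: ideal_powM.
Qed.

Hypothesis complm : madic_complete m.

Lemma coefs_in_pow_eq0 p : (forall n, coefs_in (ideal_pow m n) p) -> p = 0.
Proof.
by move=> mp; apply/polyP => i; rewrite coef0; apply: complm.1 => n; exact: mp.
Qed.

Lemma madic_limit (u : nat -> R) : (forall n, ideal_pow m n (u n.+1 - u n)) ->
  exists l, forall n, ideal_pow m n (l - u n).
Proof.
move=> cauchyu.
have tail n k : (n <= k)%N -> ideal_pow m n (u k - u n).
  move=> /subnK <-; elim: (k - n)%N => [|d IH].
    by rewrite subrr; exact: ideal0 (is_ideal_pow n).
  rewrite addSn -(subrK (u (d + n)%N) (u _)) -addrA.
  apply: (idealD (is_ideal_pow n)) IH.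
  exact: ideal_powW (leq_addl _ _) _ (cauchyu _).
have [k|l liml] := complm.2 u.
  exists k => i j le_ki le_kj.
  have -> : u i - u j = (u i - u k) - (u j - u k) by ring.
  by apply: (idealB (is_ideal_pow k)); exact: tail.
exists l => n; have [N near_l] := liml n.
have -> : l - u n = (u (maxn N n) - u n) - (u (maxn N n) - l) by ring.
apply: (idealB (is_ideal_pow n)); first exact/tail/leq_maxr.
exact/near_l/leq_maxl.
Qed.

Lemma madic_poly_limit d (p : nat -> {poly R}) :
  (forall n, size (p n) <= d)%N ->
  (forall n, coefs_in (ideal_pow m n) (p n.+1 - p n)) ->
  exists2 L : {poly R}, (size L <= d)%N &
    forall n, coefs_in (ideal_pow m n) (L - p n).
Proof.
move=> sizep cauchyp.
have /choice[l liml] i : exists l, forall n, ideal_pow m n (l - (p n)`_i).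
  by apply: madic_limit => n; rewrite -coefB; exact: cauchyp.
exists (\poly_(i < d) l i) => [|n i]; first exact: size_poly.
rewrite coefB coef_poly; case: ltnP => // le_di.
rewrite nth_default ?subrr; first exact: ideal0 (is_ideal_pow n).
exact: leq_trans (sizep n) le_di.
Qed.

Lemma madic_monic_limit d (p : nat -> {poly R}) :
  (forall n, monic_of_degree d (p n)) ->
  (forall n, coefs_in (ideal_pow m n) (p n.+1 - p n)) ->
  exists2 L, monic_of_degree d L & forall n, coefs_in (ideal_pow m n) (L - p n).
Proof.
move=> monp cauchyp.
have [n|n|L sizeL limL] := madic_poly_limit (d := d) (p := fun n => p n - 'X^d).
- exact/monic_of_degreeP.
- by rewrite (_ : _ - _ = p n.+1 - p n); [exact: cauchyp | ring].
exists ('X^d + L) => [|n].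
  exact: monic_of_degreeD (monic_of_degree_Xn _ _) _.
by rewrite (_ : _ - _ = L - (p n - 'X^d)); [exact: limL | ring].
Qed.

Section Lifting.
Variables (e h : nat) (F G0 H0 U V : {poly R}).
Hypotheses (monF : monic_of_degree (e + h) F) (monG0 : monic_of_degree e G0).
Hypotheses (monH0 : monic_of_degree h H0) (bezout : U * G0 + V * H0 = 1).

Definition factors_mod n (z : {poly R} * {poly R}) : Prop :=
  [/\ monic_of_degree e z.1, monic_of_degree h z.2,
      coefs_in m (z.1 - G0), coefs_in m (z.2 - H0) &
      coefs_in (ideal_pow m n) (F - z.1 * z.2)].

Definition close_pairs n (z z' : {poly R} * {poly R}) : Prop :=
  coefs_in (ideal_pow m n) (z'.1 - z.1) /\
  coefs_in (ideal_pow m n) (z'.2 - z.2).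

(* The corrections solve [dG * H0 + dH * G0 = F - G * H], in which [G0] and [H0]
   agree with [G] and [H] modulo [m]. *)
Lemma hensel_step n z : factors_mod n.+1 z ->
  exists2 z', factors_mod n.+2 z' & close_pairs n z z'.
Proof.
case: z => G H [/= monG monH GG0 HH0 mD]; set D := F - G * H in mD.
have idX := is_ideal_coefs_in idm; have idXn2 := is_ideal_coefs_in_pow n.+2.
have sizeD : (size D <= e + h)%N.
  by apply: size_monicB => //; exact: monic_of_degreeM.
have [dG [dH [sizedG sizedH mdG mdH DE]]] :=
  bezout_bounded (is_ideal_pow n.+1) monG0 monH0 bezout sizeD mD.
have in_m p : coefs_in (ideal_pow m n.+1) p -> coefs_in m p.
  by move=> mp; rewrite -ideal_pow1; exact: coefs_in_powW mp.
exists (G + dG, H + dH); last first.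
  by split; rewrite /= addrAC subrr add0r; apply: coefs_in_powW (leqnSn n) _.
split=> /=; [exact: monic_of_degreeD | exact: monic_of_degreeD | | | ].
- by rewrite addrAC; apply: (idealD idX) => //; exact: in_m.
- by rewrite addrAC; apply: (idealD idX) => //; exact: in_m.
have -> : F - (G + dG) * (H + dH) =
    - ((H - H0) * dG + (G - G0) * dH + dG * dH).
  have -> : F = dG * H0 + dH * G0 + G * H by rewrite DE /D; ring.
  by ring.
apply: (idealN idXn2); apply: (idealD idXn2); first apply: (idealD idXn2).
- exact: coefs_in_powM.
- exact: coefs_in_powM.
- by apply: coefs_in_powM => //; exact: in_m.
Qed.

Lemma hensel_lifting : coefs_in m (F - G0 * H0) ->
  exists G H, [/\ F = G * H, monic_of_degree e G, monic_of_degree h H,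
    coefs_in m (G - G0) & coefs_in m (H - H0)].
Proof.
move=> FGH0; have idX := is_ideal_coefs_in idm.
have [||z [zP close_z]] := @dependent_choice _ (fun n => factors_mod n.+1)
    close_pairs (G0, H0).
- by split; rewrite ?ideal_pow1 /= ?subrr //; exact: ideal0 idX.
- exact: hensel_step.
have [n|n|G monG limG] := madic_monic_limit (d := e) (p := fun n => (z n).1).
- by have [] := zP n.
- by have [] := close_z n.
have [n|n|H monH limH] := madic_monic_limit (d := h) (p := fun n => (z n).2).
- by have [] := zP n.
- by have [] := close_z n.
have [_ _ zG0 zH0 _] := zP 1%N.
exists G, H; split=> //.
- apply/eqP; rewrite -subr_eq0; apply/eqP/coefs_in_pow_eq0 => n.
  have idXn := is_ideal_coefs_in_pow n; have [_ _ _ _ zF] := zP n.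
  have -> : F - G * H =
    F - (z n).1 * (z n).2 - (G - (z n).1) * H - (H - (z n).2) * (z n).1 by ring.
  apply: (idealB idXn); first apply: (idealB idXn).
  + exact: coefs_in_powW (leqnSn n) zF.
  + exact: (ideal_mulr H idXn (limG n)).
  + exact: (ideal_mulr (z n).1 idXn (limH n)).
- have -> : G - G0 = (G - (z 1%N).1) + ((z 1%N).1 - G0) by ring.
  by apply: (idealD idX) => //; rewrite -ideal_pow1; exact: limG.
- have -> : H - H0 = (H - (z 1%N).2) + ((z 1%N).2 - H0) by ring.
  by apply: (idealD idX) => //; rewrite -ideal_pow1; exact: limH.
Qed.

End Lifting.

Definition distinguished n q : Prop :=
  monic_of_degree n q /\ forall i, (i < n)%N -> m q`_i.

Hypothesis locR : local_ring_with m.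

Lemma monic_distinguished_factor d F : monic_of_degree d F ->
  exists e h G H, [/\ d = (e + h)%N, F = G * H, distinguished e G,
    monic_of_degree h H & ~ m H`_0].
Proof.
move=> monF; have [_ [nm1 unitm]] := locR.
have Fd1 : F`_d = 1 by case: monF => /monicP + sizeF; rewrite lead_coefE sizeF.
have exe : exists e, `[< ~ m F`_e >] by exists d; apply/asboolP; rewrite Fd1.
case: (ex_minnP exe) => e /asboolP nmFe min_e.
have mF i : (i < e)%N -> m F`_i.
  move=> lt_ie; apply: contrapT => nmFi.
  by move: (min_e i (asboolT nmFi)); rewrite leqNgt lt_ie.
have le_ed : (e <= d)%N by apply: min_e; apply/asboolP; rewrite Fd1.
have [t Fet] := unitm _ nmFe.
pose H0 := drop_poly e F; have H00 : H0`_0 = F`_e by rewrite coef_drop_poly.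
have monH0 : monic_of_degree (d - e) H0.
  have sizeH0 : size H0 = (d - e).+1 by rewrite size_drop_poly monF.2 subSn.
  by split=> //; rewrite monicE lead_coefE sizeH0 coef_drop_poly subnK // Fd1.
have [|U [V bezout]] := @comaximal_Xn R e H0 t; first by rewrite H00.
have [||G [H [FGH monG monH GX HH0]]] :=
    hensel_lifting _ (monic_of_degree_Xn R e) monH0 bezout (F := F).
- by rewrite subnKC.
- move=> i; rewrite -{1}(poly_take_drop e F) mulrC addrK coef_take_poly.
  by case: ifP => [/mF //|_]; exact: ideal0.
exists e, (d - e)%N, G, H; split=> //; first by rewrite subnKC.
  by split=> // i lt_ie; have := GX i; rewrite coefB coefXn ltn_eqF // subr0.
move=> mH0; apply: nmFe; rewrite -H00 -(subKr H`_0 H0`_0) -coefB.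
exact: idealB.
Qed.

Hypothesis algm : residue_alg_closed m.

Lemma monic_split_distinguished n p : monic_of_degree n.+1 p ->
  exists c k l q p', [/\ n = (k + l)%N, distinguished k.+1 q,
    monic_of_degree l p' & p = (q \Po ('X - c%:P)) * p'].
Proof.
move=> [monp sizep]; have [|c mpc] := algm monp; first by rewrite sizep.
have monXc a : monic_of_degree 1 ('X + a%:P : {poly R}).
  by split; [exact: monicXaddC | exact: size_XaddC].
have monXNc : monic_of_degree 1 ('X - c%:P) by rewrite -polyCN.
pose F := p \Po ('X + c%:P).
have monF : monic_of_degree n.+1 F.
  by rewrite -[n.+1]muln1; exact: monic_of_degree_comp.
have mF0 : m F`_0 by rewrite -horner_coef0 horner_comp !hornerE.
have [e [h [G [H [deg FGH distG monH nmH0]]]]] :=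
  monic_distinguished_factor monF.
case: e => [|k] in deg distG.
  by case: nmH0; move: mF0; rewrite FGH (monic_of_degree0 distG.1) mul1r.
exists c, k, h, G, (H \Po ('X - c%:P)); split=> //; first by case: deg.
  by rewrite -[h]muln1; exact: monic_of_degree_comp.
by rewrite -comp_polyM -FGH comp_polyXaddC_K.
Qed.

End Hensel.

Section IntegralElements.
Variables (R S : comNzRingType) (f : {rmorphism R -> S}).

(* Cayley-Hamilton: [x] acts on the generators through a matrix [M] over [R],
   so [\det (x - M)] annihilates them, hence also [1]. *)
Lemma module_finite_integral : module_finite f -> integralRange f.
Proof.
move=> [s gen] x; pose n := size s.
have /choice[C mul_gen] (j : 'I_n) :
    exists c : seq R, x * s`_j = \sum_(i < n) f c`_i * s`_i.
  exact: gen.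
pose M : 'M[R]_n := \matrix_(j, k) (C j)`_k.
pose A := x%:M - map_mx f M; pose v : 'cV[S]_n := \col_j s`_j.
have Av : A *m v = 0.
  apply/matrixP => j k; rewrite mulmxBl mul_scalar_mx !mxE mul_gen.
  apply/eqP; rewrite subr_eq0; apply/eqP.
  by apply: eq_bigr => i _; rewrite !mxE.
have detAv : \det A *: v = 0.
  by rewrite -mul_scalar_mx -mul_adj_mx -mulmxA Av mulmx0.
have detA : \det A = 0.
  have [c one_gen] := gen 1.
  rewrite -[LHS]mulr1 one_gen mulr_sumr big1 // => i _.
  have /matrixP/(_ i 0) := detAv; rewrite !mxE mulrCA => ->.
  by rewrite mulr0.
exists (char_poly M); first exact: char_poly_monic.
apply/rootP; rewrite map_char_poly -[LHS]/(horner_eval x _) /char_poly.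
rewrite -det_map_mx -detA.
congr (\det _); apply/matrixP => i j.
by rewrite !mxE /= /horner_eval hornerD hornerN hornerC hornerMn hornerX.
Qed.

Lemma integral_incomparable (P Q : set S) : integralRange f ->
  prime_ideal P -> prime_ideal Q -> Q `<=` P ->
  (forall x, P (f x) -> x = 0) -> P `<=` Q.
Proof.
move=> intS [idP _] [idQ [_ primeQ]] QP P0 t Pt.
have [p monp /rootP pt] := intS t.
have : Q (map_poly f p).[t] by rewrite pt; exact: ideal0.
elim/poly_ind: p monp {pt} => [|p c IH] monp.
  by move: monp; rewrite monicE lead_coef0 eq_sym oner_eq0.
rewrite rmorphD rmorphM /= map_polyX map_polyC.
rewrite hornerD hornerMX hornerC /= => Qpt.
have c0 : c = 0.
  apply: P0; rewrite -[f c](addKr ((map_poly f p).[t] * t)) addrC.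
  by apply: idealB => //; [exact: QP | exact: ideal_mull].
move: monp Qpt; rewrite c0 !rmorph0 !addr0 monicE lead_coefMX -monicE => monp.
by move=> /primeQ[/(IH monp)|].
Qed.

Lemma kernel_prime :
  GRing.integral_domain_axiom S -> prime_ideal (f @^-1` [set 0]).
Proof.
move=> domS; split.
  split; first exact: rmorph0.
  split=> [x y|a x] /=; first by rewrite rmorphD => -> ->; rewrite addr0.
  by rewrite rmorphM => ->; rewrite mulr0.
split=> [|x y] /=; first by rewrite rmorph1 => /eqP; rewrite oner_eq0.
by rewrite rmorphM => /domS/orP[]/eqP; [left | right].
Qed.

Lemma prime_over_zero : GRing.integral_domain_axiom R -> injective f ->
  exists2 P, prime_ideal P & forall x, P (f x) -> x = 0.
Proof.
move=> domR injf; have [||P prP PA] := @prime_avoiding S (f @` ~` [set 0]).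
- split; first by exists 1; [exact/eqP/oner_neq0 | exact: rmorph1].
  move=> _ _ [x x0 <-] [y y0 <-]; exists (x * y); last exact: rmorphM.
  by move=> /= /domR/orP[]/eqP.
- by move=> [x x0]; rewrite -(rmorph0 f) => /injf.
exists P => // x Pfx; apply: contrapT => x_neq0.
by apply: (PA (f x)) => //; exists x.
Qed.

Lemma monic_poly_of_coefs (q : {poly R}) n : monic_of_degree n q ->
  monic_poly_of (fun j : 'I_n => q`_(n - j.+1)) = q.
Proof.
move=> [/monicP monq sizeq]; rewrite -[RHS]coefK poly_def sizeq big_ord_recr /=.
move: monq; rewrite lead_coefE sizeq => ->; rewrite scale1r addrC.
congr (_ + _); rewrite (reindex_inj rev_ord_inj) /=; apply: eq_bigr => i _.
by rewrite mul_polyC subnSK // subKn // ltnW.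
Qed.

(* The equation of [s] is a product of translates of distinguished polynomials,
   and one of the factors kills [s]. *)
Lemma integral_distinguished_translate (m : set R) (s : S) :
  local_ring_with m -> madic_complete m -> residue_alg_closed m ->
  GRing.integral_domain_axiom S -> integralOver f s ->
  exists c k (a : 'I_k.+1 -> R),
    (forall j, m (a j)) /\ (map_poly f (monic_poly_of a)).[s - f c] = 0.
Proof.
move=> locR complm algm domS [p monp /rootP].
have [n monnp] : exists n, monic_of_degree n p.
  by exists (size p).-1; split=> //; rewrite prednK // size_poly_gt0 monic_neq0.
have [d le_nd] := ubnP n; elim: d n p {monp} le_nd monnp => // d IH n p.
case: n => [_ /monic_of_degree0 ->|n lt_nd monp].
  by rewrite rmorph1 hornerC => /eqP; rewrite oner_eq0.
have [c [k [l [q [p' [nkl [monq mq] monp' ->]]]]]] :=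
  monic_split_distinguished locR.1 complm locR algm monp.
rewrite rmorphM /= hornerM => /domS/orP[]/eqP; last by apply: (IH l) => //; lia.
rewrite map_comp_poly horner_comp rmorphB /= map_polyX map_polyC hornerXsubC.
exists c, k, (fun j => q`_(k.+1 - j.+1)); rewrite monic_poly_of_coefs //.
by split=> // j; apply: mq; lia.
Qed.

End IntegralElements.

Lemma kernel_height_zero (R T S : comNzRingType) (g : {rmorphism R -> T})
  (h : {rmorphism T -> S}) :
  GRing.integral_domain_axiom S -> integralRange g -> injective (h \o g) ->
  height_zero (h @^-1` [set 0]).
Proof.
move=> domS intT injhg; have prJ := kernel_prime h domS.
exists (h @^-1` [set 0]); split=> //; split=> // -[c [[primec strictc] cJ]].
have [c01 [x [c1x nc0x]]] := strictc 0%N isT; apply: nc0x.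
apply: (integral_incomparable intT prJ (primec 0%N isT)); last exact/cJ.
  by move=> t /c01 /cJ.
by move=> a hga0; apply: injhg; rewrite /= hga0 !rmorph0.
Qed.

Definition is_quotient (A Q : comNzRingType) (I : set A)
    (pi : {rmorphism A -> Q}) : Prop :=
  (forall y, exists x, pi x = y) /\ forall x, pi x = 0 <-> I x.

Section Quotients.
Variable A : comNzRingType.
Implicit Types (I P : set A).

Lemma quotient_exists I : is_ideal I -> ~ I 1 ->
  exists (Q : comNzRingType) (pi : {rmorphism A -> Q}), is_quotient I pi.
Proof.
move=> idI nI1; pose I_bool : {pred A} := fun x => `[< I x >].
have closedI : idealr_closed I_bool.
  split; [by apply/asboolP; exact: ideal0 | by apply/asboolP |].
  move=> a x y /asboolP Ix /asboolP Iy; apply/asboolP.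
  by apply: idealD => //; exact: ideal_mull.
pose idealI : idealr A := HB.pack I_bool (isIdealr.Build A I_bool closedI).
pose pi : {rmorphism A -> {ideal_quot idealI}} := (\pi_{ideal_quot idealI})%qT.
exists {ideal_quot idealI}, pi; split=> [y|x].
  by exists (repr y); exact: reprK.
have pi0 : (x \in idealI) = (pi x == pi 0).
  by rewrite -{1}[x]subr0 Quotient.idealrBE.
rewrite rmorph0 in pi0; split=> [/eqP|Ix]; first by rewrite -pi0 => /asboolP.
by apply/eqP; rewrite -pi0; exact/asboolP.
Qed.

Lemma quotient_lift (Q B : comNzRingType) I (pi : {rmorphism A -> Q})
  (phi : {rmorphism A -> B}) :
  is_quotient I pi -> (forall x, I x -> phi x = 0) ->
  exists h : {rmorphism Q -> B}, forall x, h (pi x) = phi x.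
Proof.
move=> [/choice[sec secK] kerpi] phi0; pose h y := phi (sec y).
have hpi x : h (pi x) = phi x.
  apply/eqP; rewrite -subr_eq0 -rmorphB phi0 //.
  by apply/kerpi; rewrite rmorphB secK subrr.
have h_zmod : zmod_morphism h.
  by move=> x y; rewrite -(secK x) -(secK y) -rmorphB !hpi rmorphB.
have h_monoid : monoid_morphism h.
  split; first by rewrite -(rmorph1 pi) hpi rmorph1.
  by move=> x y; rewrite -(secK x) -(secK y) -rmorphM !hpi rmorphM.
pose h' : {rmorphism Q -> B} := HB.pack h
  (GRing.isZmodMorphism.Build Q B h h_zmod)
  (GRing.isMonoidMorphism.Build Q B h h_monoid).
by exists h'.
Qed.

Lemma prime_quotient_domain (Q : comNzRingType) P (pi : {rmorphism A -> Q}) :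
  prime_ideal P -> is_quotient P pi -> GRing.integral_domain_axiom Q.
Proof.
move=> [_ [_ primeP]] [surjpi kerpi] u v.
have [x <-] := surjpi u; have [y <-] := surjpi v.
rewrite -rmorphM => /kerpi/primeP Pxy; apply/orP.
by case: Pxy => /kerpi ->; [left | right].
Qed.

End Quotients.

(* [T] is [A[X] / (F)], with [x] the class of the variable. *)
Definition is_root_adjunction (A : comNzRingType) (F : {poly A})
    (T : comNzRingType) (g : {rmorphism A -> T}) (x : T) : Prop :=
  [/\ (map_poly g F).[x] = 0,
      forall t, exists p : {poly A}, (map_poly g p).[x] = t &
      forall (T' : comNzRingType) (g' : {rmorphism A -> T'}) (x' : T'),
        (map_poly g' F).[x'] = 0 ->
        exists h : {rmorphism T -> T'}, (forall a, h (g a) = g' a) /\ h x = x'].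

Lemma root_adjunction_exists (A : comNzRingType) (F : {poly A}) :
  F \is monic -> (1 < size F)%N ->
  exists (T : comNzRingType) (g : {rmorphism A -> T}) (x : T),
    is_root_adjunction F g x.
Proof.
move=> monF sizeF; have id0 := @is_ideal_zero {poly A}.
have nF1 : ~ adjoin [set 0] F 1.
  move=> [_ [q [->]]]; rewrite add0r => qF1; have q_neq0 : q != 0.
    by apply/eqP => q0; move/eqP: qF1; rewrite q0 mul0r oner_eq0.
  move/(congr1 (fun p : {poly A} => size p)): qF1.
  rewrite size_poly1 size_Mmonic //.
  by move: q_neq0; rewrite -size_poly_eq0; lia.
have [T [pi quopi]] := quotient_exists (is_ideal_adjoin F id0) nF1.
have [surjpi kerpi] := quopi.
pose g : {rmorphism A -> T} := (pi \o @polyC A)%FUN.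
have horner_pi p : (map_poly g p).[pi 'X] = pi p.
  by rewrite (map_poly_comp pi polyC) horner_map -/(p \Po 'X) comp_polyXr.
exists T, g, (pi 'X); split=> [|t|T' g' x' x'F].
- by rewrite horner_pi; apply/kerpi; exact: mem_adjoin.
- by have [p <-] := surjpi t; exists p.
pose phi : {rmorphism {poly A} -> T'} := (horner_eval x' \o map_poly g')%FUN.
have phiE p : phi p = (map_poly g' p).[x'] by [].
have [_ [_ [q [-> ->]]]|h hpi] := quotient_lift (phi := phi) quopi.
  by rewrite add0r rmorphM !phiE x'F mulr0.
exists h; split=> [a|]; first by rewrite /= hpi phiE map_polyC hornerC.
by rewrite hpi phiE map_polyX hornerX.
Qed.

Definition cons_roots (r : nat) (T1 T : comNzRingType) (g : {rmorphism T1 -> T})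
    (x : T) (y1 : 'I_r -> T1) (i : 'I_r.+1) : T :=
  if unlift ord0 i is Some j then g (y1 j) else x.

Lemma poly_quotient_cons (R : comNzRingType) r (F : 'I_r.+1 -> {poly R})
  (T1 T : comNzRingType) (g1 : {rmorphism R -> T1}) (g : {rmorphism T1 -> T})
  (y1 : 'I_r -> T1) (x : T) :
  is_poly_quotient (fun i => F (lift ord0 i)) g1 y1 ->
  is_root_adjunction (map_poly g1 (F ord0)) g x ->
  is_poly_quotient F (g \o g1) (cons_roots g x y1).
Proof.
move=> [y1F univ1] [xF genT univT]; set y := cons_roots _ _ _.
have y0 : y ord0 = x by rewrite /y /cons_roots unlift_none.
have yS j : y (lift ord0 j) = g (y1 j) by rewrite /y /cons_roots liftK.
split=> [i|T' g' y' y'F].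
  rewrite map_poly_comp; case: (unliftP ord0 i) => [j|] ->; last by rewrite y0.
  by rewrite yS horner_map y1F rmorph0.
have [[h1 [h1g h1y]] uniq1] :=
  univ1 T' g' (fun j => y' (lift ord0 j)) (fun j => y'F _).
have h1F : (map_poly h1 (map_poly g1 (F ord0))).[y' ord0] = 0.
  by rewrite -map_poly_comp (eq_map_poly (g := g')).
split.
  have [h [hg hx]] := univT T' h1 (y' ord0) h1F.
  exists h; split=> [a|i]; first by rewrite /= hg.
  by case: (unliftP ord0 i) => [j|] ->; rewrite ?yS ?y0 // hg.
move=> k1 k2 k1g k1y k2g k2y t; have [p <-] := genT t.
have k12g c : k1 (g c) = k2 (g c).
  by apply: (uniq1 (k1 \o g)%FUN (k2 \o g)%FUN) => // j /=; rewrite -yS.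
rewrite -!horner_map -y0 k1y k2y -!map_poly_comp; congr horner.
exact: eq_map_poly.
Qed.

Lemma poly_quotient_exists (R : comNzRingType) r (F : 'I_r -> {poly R}) :
  (forall i, F i \is monic /\ (1 < size (F i))%N) ->
  exists (T : comNzRingType) (g : {rmorphism R -> T}) (y : 'I_r -> T),
    is_poly_quotient F g y /\ integralRange g.
Proof.
elim: r F => [|r IH] F monF.
  exists R, idfun, (fun=> 0).
  split; last by move=> t; exact: (integral_id idfun).
  split=> [[]//|T' g' y' _]; split; first by exists g'; split=> // -[].
  by move=> h1 h2 h1g _ h2g _ t; rewrite h1g h2g.
have [T1 [g1 [y1 [quo1 int1]]]] :=
  IH (fun i => F (lift ord0 i)) (fun i => monF _).
have [monF0 sizeF0] := monF ord0.
have [||T [g [x adjx]]] := @root_adjunction_exists T1 (map_poly g1 (F ord0)).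
- exact: monic_map.
- by rewrite size_map_poly_id0 // (monicP monF0) rmorph1 oner_eq0.
exists T, (g \o g1)%FUN, (cons_roots g x y1).
split=> [|t]; first exact: poly_quotient_cons.
have [xF genT _] := adjx; have [p <-] := genT t.
apply: integral_horner; last first.
  by exists (F ord0) => //; apply/rootP; rewrite map_poly_comp.
by apply/integral_poly => i; rewrite coef_map; exact/integral_rmorph/int1.
Qed.

Lemma monic_poly_of_monic (R : comNzRingType) n (a : 'I_n -> R) :
  monic_of_degree n (monic_poly_of a).
Proof.
apply/monic_of_degreeP/leq_sizeP => k le_nk.
rewrite /monic_poly_of addrAC subrr add0r coef_sum big1 // => j _.
rewrite coefCM coefXn gtn_eqF ?mulr0 //.
by have := ltn_ord j; lia.
Qed.

Lemma module_finite_quotient (R S Q : comNzRingType) (f : {rmorphism R -> S})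
  (pi : {rmorphism S -> Q}) : (forall y, exists x, pi x = y) ->
  module_finite f -> module_finite (pi \o f).
Proof.
move=> surjpi [s gen]; exists [seq pi z | z <- s] => u.
have [x <-] := surjpi u; have [c ->] := gen x; exists c.
rewrite size_map rmorph_sum; apply: eq_bigr => i _.
by rewrite rmorphM (nth_map 0).
Qed.

Lemma direct_summand_comp (R S Q : comNzRingType) (f : {rmorphism R -> S})
  (pi : {rmorphism S -> Q}) : direct_summand (pi \o f) -> direct_summand f.
Proof.
move=> [rho [rho_lin rho1]].
exists (rho \o pi); split; last by rewrite /= rmorph1.
by move=> a x y; rewrite /= rmorphD rmorphM rho_lin.
Qed.

Lemma direct_summand_quotient (R T S : comNzRingType) (g : {rmorphism R -> T})
  (f : {rmorphism R -> S}) (h : {rmorphism T -> S}) (rho : T -> R) :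
  (forall x, exists t, h t = x) -> (forall a, h (g a) = f a) ->
  R_linear g rho -> rho 1 = 1 -> (forall t, h t = 0 -> rho t = 0) ->
  direct_summand f.
Proof.
move=> /choice[sec secK] hg rho_lin rho1 rho0.
have rho_eq t u : h t = h u -> rho t = rho u.
  move=> htu; rewrite -(subrK u t) -[t - u]mul1r -(rmorph1 g) rho_lin mul1r.
  by rewrite rho0 ?add0r // rmorphB htu subrr.
exists (rho \o sec); split=> [b x z|]; last first.
  by rewrite -rho1; apply: rho_eq; rewrite secK rmorph1.
by rewrite /= -rho_lin; apply: rho_eq; rewrite rmorphD rmorphM hg !secK.
Qed.

Lemma distinguished_cover (R S : comNzRingType) (m : set R)
  (f : {rmorphism R -> S}) :
  local_ring_with m -> madic_complete m -> residue_alg_closed m ->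
  GRing.integral_domain_axiom S -> module_finite f ->
  exists r (n : 'I_r -> nat) (a : forall i : 'I_r, 'I_(n i) -> R),
  [/\ (0 < r)%N, forall i, (0 < n i)%N, forall i j, m (a i j) &
    exists (T : comNzRingType) (g : {rmorphism R -> T}) (y : 'I_r -> T)
      (h : {rmorphism T -> S}),
    [/\ is_poly_quotient (fun i => monic_poly_of (a i)) g y, integralRange g,
        forall b, h (g b) = f b & forall x, exists t, h t = x]].
Proof.
move=> locR complm algm domS finf; have [s gen] := finf.
have /choice[w wP] (i : 'I_(size s)) : exists w : R * {k : nat & 'I_k.+1 -> R},
    (forall j, m (tagged w.2 j)) /\
    (map_poly f (monic_poly_of (tagged w.2))).[s`_i - f w.1] = 0.
  have [c [k [a ak]]] := integral_distinguished_translate locR complm algm domS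
    (module_finite_integral finf s`_i).
  by exists (c, Tagged (fun k => 'I_k.+1 -> R) a).
exists (size s), (fun i => (tag (w i).2).+1), (fun i => tagged (w i).2).
split=> [||i j|]; [|by []|by have [] := wP i|].
  rewrite lt0n size_eq0; apply/eqP => s0; have [c] := gen 1.
  by rewrite s0 big_ord0 => /eqP; rewrite oner_eq0.
have [i|T [g [y [quoT intT]]]] :=
    @poly_quotient_exists R _ (fun i => monic_poly_of (tagged (w i).2)).
  by have [-> ->] := monic_poly_of_monic (tagged (w i).2).
have [|[h [hg hy]] _] := quoT.2 S f (fun i => s`_i - f (w i).1).
  by move=> i; have [] := wP i.
exists T, g, y, h; split=> // x; have [c ->] := gen x.
exists (\sum_(i < size s) g c`_i * (y i + g (w i).1)).
rewrite rmorph_sum; apply: eq_bigr => i _.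
by rewrite rmorphM rmorphD !hg hy subrK.
Qed.

Definition distinguished_quotients_split (R : comNzRingType)
    (m : set R) : Prop :=
  forall (r : nat) (n : 'I_r -> nat) (a : forall i : 'I_r, 'I_(n i) -> R),
  (0 < r)%N -> (forall i, (0 < n i)%N) -> (forall i j, m (a i j)) ->
  forall (T : comNzRingType) (g : {rmorphism R -> T}) (y : 'I_r -> T),
    is_poly_quotient (fun i => monic_poly_of (a i)) g y ->
    forall J : T -> Prop, is_ideal J -> height_zero J ->
    (forall x, J (g x) -> x = 0) ->
    exists rho : T -> R,
      R_linear g rho /\ rho 1 = 1 /\ (forall t, J t -> rho t = 0).

Lemma domain_direct_summand (R S : comNzRingType) (m : set R)
  (f : {rmorphism R -> S}) :
  local_ring_with m -> madic_complete m -> residue_alg_closed m ->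
  distinguished_quotients_split m -> GRing.integral_domain_axiom S ->
  injective f -> module_finite f -> direct_summand f.
Proof.
move=> locR complm algm splitm domS injf finf.
have [r [n [a [r_gt0 n_gt0 ma [T [g [y [h [quoT intT hg surjh]]]]]]]]] :=
  distinguished_cover locR complm algm domS finf.
have injhg : injective (h \o g) by move=> b c; rewrite /= !hg; exact: injf.
have [|rho [rho_lin [rho1 rho0]]] := splitm r n a r_gt0 n_gt0 ma T g y quoT
    (h @^-1` [set 0]) (kernel_prime h domS).1
    (kernel_height_zero domS intT injhg).
  by move=> b hgb0; apply: injhg; rewrite /= hgb0 !rmorph0.
exact: direct_summand_quotient surjh hg rho_lin rho1 rho0.
Qed.

Theorem theorem5 (R : comNzRingType) (m : R -> Prop)
  (HR : complete_regular_local_alg_closed m)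
  (Hsummand : forall (r : nat) (n : 'I_r -> nat) (a : forall i : 'I_r, 'I_(n i) -> R),
     (0 < r)%N -> (forall i, (0 < n i)%N) -> (forall i j, m (a i j)) ->
     forall (T : comNzRingType) (g : {rmorphism R -> T}) (y : 'I_r -> T),
       is_poly_quotient (fun i => monic_poly_of (a i)) g y ->
       forall J : T -> Prop, is_ideal J -> height_zero J ->
       (* R -> T/J is injective *)
       (forall x, J (g x) -> x = 0) ->
       (* R is a direct summand of T/J: an R-linear T/J -> R sending 1 to 1 *)
       exists rho : T -> R, R_linear g rho /\ rho 1 = 1 /\ (forall t, J t -> rho t = 0)) :
  forall (S : comNzRingType) (f : {rmorphism R -> S}),
    injective f -> module_finite f -> direct_summand f.
Proof.
move=> S f injf finf; have [noeR [locR [complm [regm algm]]]] := HR.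
have domR := regular_local_domain noeR locR regm.
have [P prP P0] := prime_over_zero domR injf.
have [Q [pi quopi]] := quotient_exists prP.1 prP.2.1.
apply: (direct_summand_comp (pi := pi)).
apply: (domain_direct_summand locR complm algm Hsummand).
- exact: prime_quotient_domain prP quopi.
- by apply/raddf_inj => x /quopi.2; exact: P0.
- exact: module_finite_quotient quopi.1 finf.
Qed.
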